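(* Let $(\mathcal{H},\mathcal{C})$ be an edge colored hypergraph with vertex set $[\ell]$ and set of edge colors $\Lambda$, such that every color in $\Lambda$ is the color of at least one edge and $\lambda\not\Subset\lambda'$ for all distinct $\lambda,\lambda'\in\Lambda$. Let $\mathcal{A}_{(\mathcal{H},\mathcal{C})}$ be the associated edge colored hypergraphic arrangement in $V=\mathbb{C}^\ell$. Then the characteristic polynomial of the arrangement equals the chromatic polynomial of the edge colored hypergraph: $$\chi(\mathcal{A}_{(\mathcal{H},\mathcal{C})},t)=\chi(\mathcal{H},\mathcal{C},t).$$
   Context: A hypergraph $\mathcal{H}=([\ell],E)$, $[\ell]=\{1,\dots,\ell\}$, is given by a finite collection $E$ of subsets (edges) of $[\ell]$, each with at least two elements. An edge coloring is a function $\mathcal{C}:E\to\Lambda$ to a finite set $\Lambda$; the pair $(\mathcal{H},\mathcal{C})$ is an edge colored hypergraph. For an edge $e=\{i_1,\dots,i_s\}$ put $\nu(e)=\{v\in V: v_{i_1}=\cdots=v_{i_s}\}$, and for $\lambda\in\Lambda$ put $X_\lambda=\bigcap_{e\in\mathcal{C}^{-1}(\lambda)}\nu(e)$. The associated arrangement is $\mathcal{A}_{(\mathcal{H},\mathcal{C})}=\{X_\lambda\}_{\lambda\in\Lambda}$. A set of edges is connected if any two vertices in its union are joined by a chain of consecutively intersecting edges from the set; connected components of a set of edges are its maximal connected subsets. For $\lambda,\lambda'\in\Lambda$, $\lambda\Subset\lambda'$ means that the vertex set of each connected component of $\mathcal{C}^{-1}(\lambda)$ is contained in the vertex set of some connected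 component of $\mathcal{C}^{-1}(\lambda')$; equivalently, $X_\lambda\supseteq X_{\lambda'}$. For a subspace arrangement $\mathcal{A}$ in $V$, $L(\mathcal{A})$ is the set of all non-empty intersections of members of $\mathcal{A}$ (including $V$ as the empty intersection), ordered by reverse inclusion. The Möbius function $\mu:L(\mathcal{A})\to\mathbb{Z}$ is defined by $\mu(V)=1$ and $\mu(X)=-\sum_{Y\in L(\mathcal{A}),\,X\subsetneq Y}\mu(Y)$ for $X\neq V$. The characteristic polynomial is $\chi(\mathcal{A},t)=\sum_{X\in L(\mathcal{A})}\mu(X)t^{\dim X}$. A vertex coloring of $(\mathcal{H},\mathcal{C})$ with $t$ colors is a map $c:[\ell]\to\Xi$, where $\Xi$ is a set with $t$ elements. It is proper if for every $\lambda\in\Lambda$ there exist a connected component $K$ of $\mathcal{C}^{-1}(\lambda)$ and vertices $i,j$ of $K$ with $c(i)\neq c(j)$. The chromatic polynomial $\chi(\mathcal{H},\mathcal{C},t)$ is the polynomial in $t$ whose value at each positive integer $t$ is the number of proper vertex colorings of $(\mathcal{H},\mathcal{C})$ with $t$ colors. *)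

(* Defs.v *)
From HB Require Import structures.
From mathcomp Require Import all_boot all_order all_algebra.
From mathcomp Require Export finmap.
From mathcomp Require Export reals.
From mathcomp Require Export complex.

Set Implicit Arguments.
Unset Strict Implicit.
Unset Printing Implicit Defensive.

Import Order.TTheory GRing.Theory Num.Theory.

Local Open Scope fset_scope.
Local Open Scope ring_scope.

Section Arrangement.
Variables (F : fieldType) (vT : vectType F).
Implicit Types (A : {fset {vspace vT}}) (X Y : {vspace vT}).

(* Members of an arrangement are linear subspaces, so all intersections contain
   0 and "non-empty intersection" imposes no condition.  The subfamily [B] may
   be empty, which contributes the whole space. *)
Definition intersection_lattice A : {fset {vspace vT}} :=
  [fset (\bigcap_(X <- (B : {fset {vspace vT}})) X)%VS | B in fpowerset A].

Definition proper_subv X Y : bool := (X <= Y)%VS && (X != Y).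

(* [n] bounds the recursion depth; the codimension of [X] is enough because it
   drops at each step, so that [mobius] satisfies [mobius_fullv] and
   [mobiusE]. *)
Fixpoint mobius_rec A (n : nat) X : int :=
  if X == fullv then 1
  else if n is m.+1 then
    - \sum_(Y <- intersection_lattice A | proper_subv X Y) mobius_rec A m Y
  else 0.

Definition mobius A X : int := mobius_rec A (\dim {:vT} - \dim X) X.

Definition characteristic_poly A : {poly int} :=
  \sum_(X <- intersection_lattice A) mobius A X *: 'X^(\dim X).

Lemma proper_subv_dim X Y : proper_subv X Y -> (\dim X < \dim Y)%N.
Proof.
case/andP=> sXY neXY; rewrite ltnNge; apply: contra neXY => le_d.
by rewrite eqEdim sXY.
Qed.

Lemma mobius_rec_stable A n m X :
  (\dim {:vT} - \dim X <= n)%N -> (\dim {:vT} - \dim X <= m)%N ->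
  mobius_rec A n X = mobius_rec A m X.
Proof.
have full (Z : {vspace vT}) : (\dim {:vT} - \dim Z <= 0)%N -> Z == fullv.
  by rewrite leqn0 subn_eq0 => le_d; rewrite eqEdim subvf le_d.
elim: n m X => [|n IHn] [|m] X //=.
- by move=> /full ->.
- by move=> _ /full ->.
move=> le_n le_m; case: eqP => // _; congr (- _).
apply: eq_bigr => Y /proper_subv_dim ltXY.
apply: IHn; rewrite leq_subLR.
  by apply: leq_trans (_ : (\dim X).+1 + n <= _)%N;
    rewrite ?leq_add2r // addSnnS -leq_subLR.
by apply: leq_trans (_ : (\dim X).+1 + m <= _)%N;
  rewrite ?leq_add2r // addSnnS -leq_subLR.
Qed.

Lemma mobius_fullv A : mobius A fullv = 1.
Proof. by rewrite /mobius subnn /= eqxx. Qed.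

Lemma mobiusE A X : X != fullv ->
  mobius A X = - \sum_(Y <- intersection_lattice A | proper_subv X Y) mobius A Y.
Proof.
move=> neX; rewrite {1}/mobius.
rewrite (@mobius_rec_stable A _ (\dim {:vT} - \dim X).+1) //= (negPf neX).
congr (- _); apply: eq_bigr => Y /proper_subv_dim ltXY.
by apply: mobius_rec_stable => //; apply/leq_sub2l/ltnW.
Qed.

End Arrangement.

(* The vertices 1, ..., l are renumbered 0, ..., l-1. *)
Record hypergraph (l : nat) := Hypergraph {
  edges : {set {set 'I_l}};
  edges_gt1 : forall e, e \in edges -> (1 < #|e|)%N }.

Definition edge (l : nat) (H : hypergraph l) := {e : {set 'I_l} | e \in edges H}.

Section Connectedness.
Variable T : finType.
Implicit Types (S K : {set {set T}}).

Definition meets_in S : rel {set T} :=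
  [rel e f | [&& e \in S, f \in S & e :&: f != set0]].

(* [connect] is the existence of a chain of consecutively intersecting edges. *)
Definition chained S (i j : T) : bool :=
  [exists e in S, exists f in S,
     [&& i \in e, j \in f & connect (meets_in S) e f]].

Definition edges_connected S : bool :=
  [forall i in cover S, forall j in cover S, chained S i j].

(* The empty set of edges has one component, the empty one; a nonempty set has
   only nonempty components. *)
Definition components S : {set {set {set T}}} :=
  [set K | maxset (fun K' => (K' \subset S) && edges_connected K') K].

End Connectedness.

Section EdgeColored.
Variables (l : nat) (H : hypergraph l) (Lambda : finType).
Variable C : edge H -> Lambda.

Definition color_class (lam : Lambda) : {set {set 'I_l}} :=
  [set val e | e : edge H & C e == lam].

(* The relation written with a double-subset sign: components are compared
   through their vertex sets, not their edges. *)
Definition color_le (lam lam' : Lambda) : bool :=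
  [forall K in components (color_class lam),
     exists K' in components (color_class lam'), cover K \subset cover K'].

Definition proper_coloring (Xi : finType) (c : {ffun 'I_l -> Xi}) : bool :=
  [forall lam, exists K in components (color_class lam),
     exists i in cover K, exists j in cover K, c i != c j].

Definition num_proper_colorings (t : nat) : nat :=
  #|[set c : {ffun 'I_l -> 'I_t} | proper_coloring c]|.

(* [kernel_rep c i] depends only on the level set of [c] containing [i]. *)
Definition kernel_rep (Xi : eqType) (c : 'I_l -> Xi) : {ffun 'I_l -> 'I_l} :=
  [ffun i => odflt i [pick j | c j == c i]].

Lemma kernel_repP (Xi : eqType) (c : 'I_l -> Xi) i : c (kernel_rep c i) = c i.
Proof. by rewrite ffunE; case: pickP => [j /eqP|]. Qed.

Lemma kernel_rep_eq (Xi : eqType) (c : 'I_l -> Xi) i j :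
  (kernel_rep c i == kernel_rep c j) = (c i == c j).
Proof.
apply/eqP/eqP=> [e | e]; first by rewrite -kernel_repP e kernel_repP.
rewrite !ffunE (@eq_pick _ _ (fun k => c k == c j)); last by move=> k; rewrite e.
by case: pickP => //= /(_ j); rewrite eqxx.
Qed.

Lemma kernel_rep_ext (Xi Xi' : eqType) (c : 'I_l -> Xi) (d : 'I_l -> Xi') :
  (forall i j, (c i == c j) = (d i == d j)) -> kernel_rep c = kernel_rep d.
Proof.
by move=> e; apply/ffunP=> i; rewrite !ffunE; congr (odflt _ _); apply: eq_pick => j.
Qed.

Lemma proper_kernel_rep (Xi : finType) (c : {ffun 'I_l -> Xi}) :
  proper_coloring (kernel_rep c) = proper_coloring c.
Proof.
apply: eq_forallb => lam; apply: eq_existsb => K; congr (_ && _).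
apply: eq_existsb => i; congr (_ && _); apply: eq_existsb => j.
by rewrite kernel_rep_eq.
Qed.

Lemma card_kernel_rep (r : {ffun 'I_l -> 'I_l}) (t : nat) : kernel_rep r = r ->
  #|[set c : {ffun 'I_l -> 'I_t} | kernel_rep c == r]| =
    (t ^_ #|{: {x | r x == x}}|)%N.
Proof.
move=> rr; have r_idem i : r (r i) == r i by rewrite -{2}rr kernel_repP.
pose D : finType := {x | r x == x}.
rewrite -[t in RHS]card_ord -card_inj_ffuns.
pose up (f : {ffun D -> 'I_t}) : {ffun 'I_l -> 'I_t} :=
  [ffun i => f (exist (fun x => r x == x) (r i) (r_idem i))].
have up_val f (d : D) : up f (val d) = f d.
  by rewrite ffunE; congr (f _); apply: val_inj; apply/eqP/(valP d).
have up_inj : injective up.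
  by move=> f g e; apply/ffunP=> d; rewrite -!up_val e.
rewrite -(card_imset _ up_inj); apply: eq_card => c; rewrite inE.
apply/eqP/imsetP => [rc | [f]].
  exists [ffun d : D => c (val d)].
    rewrite inE; apply/injectiveP => d d'; rewrite !ffunE => /eqP.
    rewrite -kernel_rep_eq rc (eqP (valP d)) (eqP (valP d')) => /eqP.
    exact: val_inj.
  by apply/ffunP=> i; rewrite !ffunE /= -{1}kernel_repP rc.
rewrite inE => /injectiveP f_inj ->; rewrite -[RHS]rr.
apply: kernel_rep_ext => i j; rewrite !ffunE (inj_eq f_inj).
by rewrite -val_eqE.
Qed.

Lemma horner_ffact k t :
  (\prod_(i < k) ('X - i%:R%:P : {poly int})).[t%:R] = (t ^_ k)%:R.
Proof.
elim: k => [|k IHk]; first by rewrite big_ord0 hornerC.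
rewrite big_ord_recr /= hornerM IHk hornerXsubC ffactnSr natrM.
have [le_kt | lt_tk] := leqP k t; first by rewrite natrB.
by rewrite ffact_small // !mul0r.
Qed.

Lemma chromatic_poly_exists :
  {p : {poly int} | forall t, (0 < t)%N ->
     p.[t%:R] = (num_proper_colorings t)%:R}.
Proof.
exists (\sum_(r : {ffun 'I_l -> 'I_l} | (kernel_rep r == r) && proper_coloring r)
  \prod_(i < #|{: {x | r x == x}}|) ('X - i%:R%:P)) => t _.
rewrite horner_sum /num_proper_colorings -sum1_card.
rewrite (partition_big (fun c : {ffun 'I_l -> 'I_t} => kernel_rep c)
  (fun r => (kernel_rep r == r) && proper_coloring r)) /=; last first.
  move=> c; rewrite inE proper_kernel_rep => ->; rewrite andbT; apply/eqP.
  by apply: kernel_rep_ext => i j; rewrite kernel_rep_eq.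
rewrite natr_sum; apply: eq_bigr => r /andP[/eqP rr pr].
rewrite horner_ffact -card_kernel_rep // -sum1_card; congr (_%:R).
apply: eq_bigl => c; rewrite !inE.
by case: eqP => [e|]; rewrite ?andbF ?andbT // -proper_kernel_rep e pr.
Qed.

(* The witness in [chromatic_poly_exists] is opaque: [chromatic_poly] is known
   only by its values at positive integers, which determine it
   ([chromatic_poly_unique]). *)
Definition chromatic_poly : {poly int} := sval chromatic_poly_exists.

Lemma chromatic_polyP t : (0 < t)%N ->
  chromatic_poly.[t%:R] = (num_proper_colorings t)%:R.
Proof. exact: (svalP chromatic_poly_exists). Qed.

Lemma chromatic_poly_unique (p : {poly int}) :
  (forall t, (0 < t)%N -> p.[t%:R] = (num_proper_colorings t)%:R) ->
  p = chromatic_poly.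
Proof.
move=> pP; apply/eqP; rewrite -subr_eq0; apply: contraT => nz.
pose s : seq int := [seq n.+1%:R | n <- iota 0 (size (p - chromatic_poly)%R)].
have: (size s < size (p - chromatic_poly)%R)%N.
  apply: max_poly_roots nz _ _.
    apply/allP=> _ /mapP[n _ ->]; apply/rootP.
    by rewrite hornerD hornerN pP // chromatic_polyP // subrr.
  rewrite map_inj_uniq ?iota_uniq // => m n /eqP.
  by rewrite eqr_nat => /eqP[].
by rewrite size_map size_iota ltnn.
Qed.

Section Subspaces.
Variable F : fieldType.

Definition coord_diff (i j : 'I_l) (v : 'rV[F]_l) : F^o := v 0 i - v 0 j.

Fact coord_diff_linear i j : linear (coord_diff i j).
Proof.
by move=> a u v; rewrite /coord_diff !mxE scalerBr opprD addrACA.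
Qed.

HB.instance Definition _ i j :=
  GRing.isLinear.Build F 'rV[F]_l F^o _ (coord_diff i j) (coord_diff_linear i j).

Definition edge_subspace (e : {set 'I_l}) : {vspace 'rV[F]_l} :=
  (\bigcap_(i in e) \bigcap_(j in e) lker (linfun (coord_diff i j)))%VS.

Lemma edge_subspaceP (e : {set 'I_l}) (v : 'rV[F]_l) :
  reflect {in e &, forall i j, v 0 i = v 0 j} (v \in edge_subspace e).
Proof.
apply: (iffP idP).
  rewrite memvE => /subv_bigcapP sv i j ei ej.
  have /subv_bigcapP /(_ j ej) := sv i ei.
  by rewrite -memvE memv_ker lfunE /= subr_eq0 => /eqP.
move=> eqv; rewrite memvE; apply/subv_bigcapP => i ei.
apply/subv_bigcapP => j ej.
by rewrite -memvE memv_ker lfunE /= subr_eq0 (eqv i j).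
Qed.

Definition color_subspace (lam : Lambda) : {vspace 'rV[F]_l} :=
  (\bigcap_(e in color_class lam) edge_subspace e)%VS.

Definition hypergraphic_arrangement : {fset {vspace 'rV[F]_l}} :=
  [fset color_subspace lam | lam in Lambda].

End Subspaces.
End EdgeColored.

(* Main.v *)
Require Import Defs.
From HB Require Import structures.
From mathcomp Require Import all_boot all_order all_algebra.
From mathcomp Require Import finmap reals complex.

(** Embed the colors 0, ..., t-1 in the field.  A vertex coloring [c] becomes a
    vector, which lies in the subspace of the color [lam] exactly when [c] is
    constant on every component of [lam].  A member [X] of the intersection
    lattice is cut out by equations between coordinates, so it contains
    [t ^ dim X] colorings.  Hence the value of the characteristic polynomial at
    [t] is the sum, over all colorings [c], of the sum of the Moebius function
    over the lattice elements containing [c].  Those are the elements above the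
    smallest one containing [c], so the inner sum is 1 when only the whole space
    contains [c], that is when [c] is proper, and 0 otherwise. *)

Set Implicit Arguments.
Unset Strict Implicit.
Unset Printing Implicit Defensive.

Import Order.TTheory GRing.Theory Num.Theory.

Local Open Scope fset_scope.
Local Open Scope ring_scope.

(** * Möbius function sums over the intersection lattice *)

Section Lattice.
Variables (F : fieldType) (vT : vectType F).
Implicit Types (A : {fset {vspace vT}}) (X Y : {vspace vT}) (v : vT).

Lemma memv_bigcap_seq (s : seq {vspace vT}) v :
  (v \in (\bigcap_(X <- s) X)%VS) = all (fun X => v \in X) s.
Proof.
by elim: s => [|X s IHs]; rewrite ?big_nil ?memvf // big_cons memv_cap IHs.
Qed.

Lemma intersection_latticeP A X :
  reflect (exists2 B : {fset {vspace vT}}, B `<=` A & X = (\bigcap_(Y <- B) Y)%VS)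
          (X \in intersection_lattice A).
Proof.
apply: (iffP (imfsetP _ _ _ _)) => [[B /=] | [B sBA ->]].
  by rewrite fpowersetE => sBA ->; exists B.
by exists B; rewrite //= fpowersetE.
Qed.

Lemma fullv_lattice A : fullv \in intersection_lattice A.
Proof.
by apply/intersection_latticeP; exists fset0; rewrite ?fsub0set // big_nil.
Qed.

(** This is the recursion [mobiusE] with the term of [X] itself moved into the sum. *)
Lemma sum_mobius_above A X : X \in intersection_lattice A ->
  \sum_(Y <- intersection_lattice A | (X <= Y)%VS) mobius A Y
    = (X == fullv)%:R.
Proof.
move=> LX; rewrite big_mkcond (bigD1_seq X) ?fset_uniq //= subvv -big_mkcondr /=.
have [-> | neX] := eqVneq X fullv.
  rewrite mobius_fullv big1 ?addr0 // => Y /andP[/negP neY sY].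
  by case: neY; rewrite eqEsubv subvf.
rewrite mobiusE //= addrC; apply/eqP; rewrite subr_eq0; apply/eqP.
by apply: eq_bigl => Y; rewrite /proper_subv andbC eq_sym.
Qed.

Definition smallest_flat A v : {vspace vT} :=
  (\bigcap_(X <- [fset X in A | v \in X]) X)%VS.

Lemma smallest_flat_lattice A v : smallest_flat A v \in intersection_lattice A.
Proof.
apply/intersection_latticeP; exists [fset X in A | v \in X] => //.
by apply/fsubsetP=> X; rewrite !inE => /andP[].
Qed.

Lemma memv_smallest_flat A v : v \in smallest_flat A v.
Proof. by rewrite memv_bigcap_seq; apply/allP=> X; rewrite !inE => /andP[]. Qed.

Lemma smallest_flat_sub A v X : X \in A -> v \in X -> (smallest_flat A v <= X)%VS.
Proof.
move=> AX vX; apply/subvP=> u; rewrite memv_bigcap_seq => /allP; apply.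
by rewrite !inE /= AX.
Qed.

(** If an intersection of members contains [v], so does each of these members, and each then takes
    part in the intersection defining [smallest_flat A v]. *)
Lemma smallest_flatP A v X : X \in intersection_lattice A ->
  (v \in X) = (smallest_flat A v <= X)%VS.
Proof.
case/intersection_latticeP=> B /fsubsetP sBA ->; apply/idP/idP => [|/subvP]; last first.
  by apply; apply: memv_smallest_flat.
rewrite memv_bigcap_seq => /allP vB; apply/subvP=> u uX.
rewrite memv_bigcap_seq; apply/allP=> Y BY.
by apply: (subvP (smallest_flat_sub (sBA _ BY) (vB _ BY))).
Qed.

Lemma sum_mobius_containing A v :
  \sum_(X <- intersection_lattice A | v \in X) mobius A X
    = (smallest_flat A v == fullv)%:R.
Proof.
(* [smallest_flatP] needs membership in the lattice, so it is first put into both summation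
   conditions. *)
rewrite -(sum_mobius_above (smallest_flat_lattice A v)) big_seq_cond [RHS]big_seq_cond.
apply: eq_bigl => X; case LX: (X \in _) => //=.
by rewrite (smallest_flatP v LX).
Qed.

(** A member containing [v] lies above the smallest flat. If that flat is the whole space, so is the
    member, which the hypothesis excludes. *)
Lemma smallest_flat_full A v : fullv \notin A ->
  (smallest_flat A v == fullv) = [forall X : A, v \notin val X].
Proof.
move=> nAf; apply/eqP/forallP => [sf X | nv].
  apply: contra nAf => vX.
  have := smallest_flat_sub (valP X) vX; rewrite sf => sX.
  by rewrite -(subv_anti (_ : (val X <= fullv <= val X)%VS)) ?subvf // (valP X).
rewrite /smallest_flat (_ : [fset X in A | v \in X] = fset0) ?big_nil //.
apply/fsetP=> X; rewrite !inE; apply/negP => /andP[/= AX vX].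
by have := nv [` AX]; rewrite /= vX.
Qed.

End Lattice.

(** * Subspaces cut out by equalities of coordinates, and the colorings in them *)

Section DiagonalSubspaces.
Variable l : nat.

Definition coloring_vector (F : fieldType) t (c : {ffun 'I_l -> 'I_t}) : 'rV[F]_l :=
  \row_i (c i : nat)%:R.

(** Characteristic zero keeps distinct colors distinct in [F]. *)
Lemma coloring_vector_eq (F : numFieldType) t (c : {ffun 'I_l -> 'I_t}) i j :
  (coloring_vector F c 0 i == coloring_vector F c 0 j) = (c i == c j).
Proof. by rewrite !mxE eqr_nat. Qed.

(** [P] is an arbitrary relation, not an equivalence, so that intersecting subspaces amounts to
    taking the union of their relations. *)
Definition cut_by (F : fieldType) (X : {vspace 'rV[F]_l}) (P : rel 'I_l) :=
  forall v : 'rV[F]_l, (v \in X) = [forall i, forall j, P i j ==> (v 0 i == v 0 j)].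

Definition diagonal_subspace (F : fieldType) (X : {vspace 'rV[F]_l}) :=
  exists P, cut_by X P.

Lemma diagonal_bigcap (F : fieldType) (s : seq {vspace 'rV[F]_l}) :
  {in s, forall X, diagonal_subspace X} ->
  diagonal_subspace (\bigcap_(X <- s) X)%VS.
Proof.
elim: s => [|X s IHs] ds.
  exists (fun _ _ => false) => v; rewrite big_nil memvf.
  by apply/esym/forallP => i; apply/forallP.
have [P PX] := ds X (mem_head _ _).
case: IHs => [Y sY|Q QX]; first by apply: ds; rewrite inE sY orbT.
exists (fun i j => P i j || Q i j) => v; rewrite big_cons memv_cap PX QX.
apply/andP/idP => [[/forallP Pv /forallP Qv] | /forallP PQv].
  apply/forallP => i; apply/forallP => j; apply/implyP => /orP[].
    by apply/implyP; apply: (forallP (Pv i)).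
  by apply/implyP; apply: (forallP (Qv i)).
split; apply/forallP => i; apply/forallP => j; apply/implyP => ij;
  by apply: (implyP (forallP (PQv i) j)); rewrite ij ?orbT.
Qed.

Section Retraction.
Variable r : 'I_l -> 'I_l.
Hypothesis r_idem : forall i, r (r i) == r i.

Let D : finType := {x | r x == x}.
Let retr (i : 'I_l) : D := exist (fun x => r x == x) (r i) (r_idem i).

Let retr_val (d : D) : retr (val d) = d.
Proof. by apply: val_inj; apply/eqP/(valP d). Qed.

(** A coloring constant along [r] is determined by its values on the fixed points of [r], and these
    are free. *)
Lemma card_retract_colorings t :
  #|[set c : {ffun 'I_l -> 'I_t} | [forall i, c i == c (r i)]]| = (t ^ #|D|)%N.
Proof.
rewrite -[t in RHS]card_ord -card_ffun -cardsT.
pose up (f : {ffun D -> 'I_t}) : {ffun 'I_l -> 'I_t} := [ffun i => f (retr i)].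
have up_inj : injective up.
  by move=> f g /ffunP e; apply/ffunP=> d; have := e (val d); rewrite !ffunE retr_val.
rewrite -(card_imset _ up_inj); apply: eq_card => c; rewrite inE.
apply/forallP/imsetP => [rc | [f _ -> i]].
  exists [ffun d : D => c (val d)]; first by rewrite inE.
  by apply/ffunP=> i; rewrite !ffunE; apply/eqP/rc.
rewrite !ffunE; apply/eqP; congr (f _); apply: val_inj.
by rewrite /= (eqP (r_idem i)).
Qed.

(** The linear counterpart of the preceding count: extending along [r] is an injective linear map
    from the vectors indexed by [D] onto [X]. *)
Lemma dim_retract (F : fieldType) (X : {vspace 'rV[F]_l}) :
  (forall v : 'rV[F]_l, (v \in X) = [forall i, v 0 i == v 0 (r i)]) ->
  \dim X = #|D|.
Proof.
move=> XP.
pose f (u : 'rV[F]_#|D|) : 'rV[F]_l := \row_i u 0 (enum_rank (retr i)).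
have f_lin : linear f by move=> a u v; apply/rowP=> i; rewrite !mxE.
pose fL := HB.pack_for {linear 'rV[F]_#|D| -> 'rV[F]_l} f
  (GRing.isLinear.Build F _ _ _ f f_lin).
have f_ker : lker (linfun fL) = 0%VS.
  apply/eqP; rewrite -subv0; apply/subvP=> u; rewrite memv_ker lfunE /= => /eqP e.
  rewrite memv0; apply/eqP/rowP => k.
  have /rowP/(_ (val (enum_val k))) := e.
  by rewrite !mxE retr_val enum_valK.
have -> : X = limg (linfun fL).
  apply/vspaceP => v; rewrite XP; apply/forallP/memv_imgP => [vr | [u _ ->] i].
    exists (\row_k v 0 (val (enum_val k))); first exact: memvf.
    apply/rowP=> i; rewrite lfunE /= !mxE enum_rankK.
    by apply/eqP/vr.
  rewrite lfunE /= !mxE; apply/eqP; congr (u 0 (enum_rank _)); apply: val_inj.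
  by rewrite /= (eqP (r_idem i)).
rewrite limg_dim_eq ?dimvf ?f_ker ?capv0 //.
by rewrite dim_matrix mul1r.
Qed.

End Retraction.

(** Both the dimension and the exponent in the count equal the number of connected components of the
    graph of [P]. *)
Lemma card_colorings_diagonal (F : numFieldType) (X : {vspace 'rV[F]_l}) t :
  diagonal_subspace X ->
  #|[set c : {ffun 'I_l -> 'I_t} | coloring_vector F c \in X]| = (t ^ \dim X)%N.
Proof.
case=> P XP.
(* [r] picks a representative of each class of coordinates that agree on [X]. *)
pose E : rel 'I_l := fun i j => P i j || P j i.
have Esym : connect_sym E.
  by apply: sym_connect_sym => i j; apply: orbC.
pose r := fingraph.root E.
have r_idem i : r (r i) == r i by apply/eqP/root_root.
have agree (T : eqType) (g : 'I_l -> T) :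
    [forall i, forall j, P i j ==> (g i == g j)] = [forall i, g i == g (r i)].
  apply/forallP/forallP => [gP i | gr i]; last first.
    apply/forallP => j; apply/implyP => ij.
    rewrite (eqP (gr i)) (eqP (gr j)); apply/eqP; congr g.
    by apply/(fingraph.rootP Esym)/connect1; rewrite /E ij.
  have gP' a b : P a b -> g a == g b by apply/implyP/(forallP (gP a)).
  (* The level set of [g] through [i] is closed under [E], hence contains the root of [i]. *)
  have inv : closed E [pred j | g j == g i].
    move=> a b /orP[] /gP' /eqP e; by rewrite !inE e.
  have := closed_connect inv (connect_root E i).
  by rewrite !inE eqxx eq_sym => <-.
have Xr (v : 'rV[F]_l) : (v \in X) = [forall i, v 0 i == v 0 (r i)].
  by rewrite XP (agree _ (fun i => v 0 i)).
rewrite (dim_retract r_idem Xr) -(card_retract_colorings r_idem).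
apply: eq_card => c; rewrite !inE Xr.
by apply: eq_forallb => i; rewrite coloring_vector_eq.
Qed.

End DiagonalSubspaces.

(** * Connected components of a set of edges *)

Section Components.
Variable T : finType.
Implicit Types (S K : {set {set T}}).

Lemma edges_connected1 (e : {set T}) : edges_connected [set e].
Proof.
rewrite /edges_connected cover1.
apply/forall_inP => i ei; apply/forall_inP => j ej.
apply/existsP; exists e; rewrite set11; apply/existsP; exists e.
by rewrite set11 ei ej connect0.
Qed.

(** A single edge is a connected set, so it extends to a maximal one. *)
Lemma component_of_edge S e : e \in S -> exists2 K, K \in components S & e \in K.
Proof.
move=> Se.
have [|K mK] := @maxset_exists _
    (fun K' : {set {set T}} => (K' \subset S) && edges_connected K') [set e].
  by rewrite sub1set Se edges_connected1.
by rewrite sub1set; exists K; rewrite ?inE.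
Qed.

(** Each edge lies in a component; conversely, a value constant on every edge propagates along
    chains of intersecting edges. *)
Lemma constant_on_components (Xi : eqType) (c : T -> Xi) S :
  [forall K in components S, forall i in cover K, forall j in cover K, c i == c j]
  = [forall e in S, forall i in e, forall j in e, c i == c j].
Proof.
apply/forall_inP/forall_inP => [cK e Se | ce K].
  have [K SK Ke] := component_of_edge Se.
  have sub i : i \in e -> i \in cover K.
    by move=> ei; apply/bigcupP; exists e.
  apply/forall_inP => i /sub ei; apply/forall_inP => j /sub ej.
  exact: (forall_inP (forall_inP (cK K SK) i ei)).
rewrite inE => /maxsetp /andP[/subsetP sKS conn].
have cst e i j : e \in K -> i \in e -> j \in e -> c i = c j.
  move=> /sKS Se ei ej.
  exact/eqP/(forall_inP (forall_inP (ce e Se) i ei)).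
apply/forall_inP => i Ki; apply/forall_inP => j Kj.
have /exists_inP[e Ke /exists_inP[f Kf /and3P[ei fj /connectP[p]]]] :=
  forall_inP (forall_inP conn i Ki) j Kj.
move=> + lst; rewrite {f}lst in Kf fj *.
(* Induction on the chain with its starting vertex generalized: a vertex [k] shared by the first two
   edges is the next start. *)
elim: p e i Ke ei {Ki} Kf fj => [|f p IHp] e i Ke ei /= Kf fj.
  by move=> _; apply/eqP; apply: cst fj.
case/andP => /and3P[_ Kf' /set0Pn[k /setIP[ek fk]]] pth.
rewrite (cst e i k) //; exact: IHp fk Kf fj pth.
Qed.

End Components.

(** * Proper colorings as points outside the arrangement *)

Section Coloring.
Variables (l : nat) (H : hypergraph l) (Lambda : finType) (C : edge H -> Lambda).

Lemma color_subspaceP (F : fieldType) (lam : Lambda) (v : 'rV[F]_l) :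
  (v \in color_subspace C F lam) =
    [forall e in color_class C lam, forall i in e, forall j in e, v 0 i == v 0 j].
Proof.
rewrite memvE; apply/subv_bigcapP/forall_inP => vP e le.
  have := vP e le; rewrite -memvE => /edge_subspaceP ve.
  apply/forall_inP => i ei; apply/forall_inP => j ej; apply/eqP; exact: ve.
rewrite -memvE; apply/edge_subspaceP => i j ei ej.
exact/eqP/(forall_inP (forall_inP (vP e le) i ei)).
Qed.

Lemma color_subspace_diagonal (F : fieldType) (lam : Lambda) :
  diagonal_subspace (color_subspace C F lam).
Proof.
exists (fun i j => [exists e in color_class C lam, (i \in e) && (j \in e)]) => v.
rewrite color_subspaceP; apply/forall_inP/forallP => [vP i | vP e le].
  apply/forallP => j; apply/implyP => /exists_inP[e le /andP[ei ej]].
  exact: (forall_inP (forall_inP (vP e le) i ei)).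
apply/forall_inP => i ei; apply/forall_inP => j ej.
by apply: (implyP (forallP (vP i) j)); apply/exists_inP; exists e; rewrite ?ei.
Qed.

Lemma lattice_diagonal (F : fieldType) X :
  X \in intersection_lattice (hypergraphic_arrangement C F) -> diagonal_subspace X.
Proof.
case/intersection_latticeP => B /fsubsetP sBA ->.
apply: diagonal_bigcap => Y /sBA /imfsetP[lam _ ->].
exact: color_subspace_diagonal.
Qed.

Lemma proper_coloring_vector (F : numFieldType) t (c : {ffun 'I_l -> 'I_t}) :
  proper_coloring C c =
    [forall lam, coloring_vector F c \notin color_subspace C F lam].
Proof.
apply: eq_forallb => lam; rewrite color_subspaceP.
rewrite -(constant_on_components (fun i => coloring_vector F c 0 i)).
rewrite negb_forall_in; apply: eq_existsb => K; congr (_ && _).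
rewrite negb_forall_in; apply: eq_existsb => i; congr (_ && _).
rewrite negb_forall_in; apply: eq_existsb => j; congr (_ && _).
by rewrite coloring_vector_eq.
Qed.

Lemma color_subspace_proper (F : fieldType) (e : edge H) :
  color_subspace C F (C e) != fullv.
Proof.
have [i [j [ei ej neij]]] : exists i j, [/\ i \in val e, j \in val e & i != j].
  by have /card_gt1P[i [j [? ? ?]]] := edges_gt1 (valP e); exists i, j.
(* The unit vector at [i] violates the equation between the coordinates [i] and [j] of the edge
   [e]. *)
apply/eqP => full; have := memvf (delta_mx 0 i : 'rV[F]_l).
rewrite -full color_subspaceP => /forall_inP/(_ (val e)).
have -> : val e \in color_class C (C e) by apply/imsetP; exists e; rewrite ?inE.
move=> /(_ isT)/forall_inP/(_ i ei)/forall_inP/(_ j ej).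
by rewrite !mxE !eqxx (eq_sym j) (negPf neij) oner_eq0.
Qed.

Lemma characteristic_poly_chromatic (F : numFieldType) :
  (forall lam, exists e, C e = lam) ->
  characteristic_poly (hypergraphic_arrangement C F) = chromatic_poly C.
Proof.
move=> C_surj; apply: chromatic_poly_unique => t _.
set A := hypergraphic_arrangement C F.
(* Every color is the color of some edge, so its subspace satisfies a nontrivial equation. *)
have A_full : fullv \notin A.
  apply/imfsetP => -[lam _ full]; have [e e_lam] := C_surj lam.
  by have := color_subspace_proper F e; rewrite e_lam -full eqxx.
rewrite horner_sum.
(* The power of [t] at [X] is the number of colorings lying in [X]. *)
transitivity (\sum_(X <- intersection_lattice A)
   \sum_(c : {ffun 'I_l -> 'I_t} | coloring_vector F c \in X) mobius A X).
  rewrite big_seq [RHS]big_seq; apply: eq_bigr => X /lattice_diagonal dX.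
  rewrite hornerZ hornerXn -natrX -(card_colorings_diagonal t dX).
  rewrite sumr_const mulr_natr; congr (_ *+ _).
  by apply: eq_card => c; rewrite inE.
(* After exchanging the sums, each coloring contributes the indicator of its being proper. *)
rewrite (exchange_big_dep predT) //= /num_proper_colorings -sum1_card natr_sum.
rewrite [RHS]big_mkcond; apply: eq_bigr => c _.
rewrite sum_mobius_containing smallest_flat_full // inE (proper_coloring_vector F).
rewrite (_ : [forall X : A, _] =
  [forall lam, coloring_vector F c \notin color_subspace C F lam]).
  by case: ifP.
apply/forallP/forallP => [nA lam | nlam [X /= XA]].
  have lamA : color_subspace C F lam \in A by apply/imfsetP; exists lam.
  exact: (nA [` lamA]).
by have /imfsetP[lam _ /= ->] := XA.
Qed.

End Coloring.

Theorem theorem3p8 (R : realType) (l : nat) (H : hypergraph l)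
    (Lambda : finType) (C : edge H -> Lambda)
    (C_surj : forall lam : Lambda, exists e : edge H, C e = lam)
    (C_incomparable : forall lam lam' : Lambda,
       lam != lam' -> ~~ color_le C lam lam') :
  characteristic_poly (hypergraphic_arrangement C R[i]) = chromatic_poly C.
Proof. exact: characteristic_poly_chromatic. Qed.
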